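(* The map $\beta\mapsto(\dot T,\dot U)$ (dotted Robinson–Schensted–Knuth) is a bijection between biwords over $A$ and pairs of dotted semistandard Young tableaux of the same shape, and it satisfies $\vec m(\beta)=(\vec m(\dot T),\vec m(\dot U))$.
   Context: Fix $n\ge1$ and let $A=\{i^{(k)}:i\ge1,\ 1\le k\le n\}$ ($i^{(k)}$ is the integer $i$ carrying $k$ dots), partially ordered by $i^{(k)}<j^{(l)}$ iff $i<j$. A dotted semistandard Young tableau is a filling of a Young diagram with elements of $A$ whose rows weakly increase and columns strictly increase in this order. A biword of length $N$ over $A$ is a $2\times N$ array of elements of $A$ such that, after removing dots, the columns are in weakly increasing lexicographic order with the top row taking precedence. The multidegree $\vec m(M)=[m_1,\dots,m_n]$ of a multiset $M$ of elements of $A$ records the number $m_k$ of elements with $k$ dots; for a biword $\beta$ with lower row $\check\beta$ and upper row $\hat\beta$, $\vec m(\beta)=(\vec m(\check\beta),\vec m(\hat\beta))$, and for a tableau the multidegree is that of its multiset of entries. The map sends $\beta$ to $(\dot T,\dot U)$ obtained by performing the ordinary RSK algorithm on $\beta$, comparing entries only through their underlying integers (the dots being carried along with the entries): reading columns left to right, the bottom entry is row-inserted into $\dot T$ (an inserted entry bumps the leftmost entry of the row whose integer is strictly larger, and the bumped entry is inserted into the next row), and the top entry is placed in $\dot U$ in the cell created by that insertion. *)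

(* Defs.v *)
(* MathComp, plus mathcomp-classical (functions.v) for [set_bij]. *)
From HB Require Import structures.
From mathcomp Require Import all_boot all_order.
From mathcomp Require Import classical_sets functions.

Set Implicit Arguments.
Unset Strict Implicit.
Unset Printing Implicit Defensive.

(* The alphabet A: the letter with value (i, k) is i^(k), the integer i >= 1
   carrying k dots, 1 <= k <= n. *)
Record letter (n : nat) := Letter {
  letter_val : nat * nat;
  _ : [&& 0 < letter_val.1, 0 < letter_val.2 & letter_val.2 <= n]
}.

HB.instance Definition _ n := [isSub for @letter_val n].
HB.instance Definition _ n := [Choice of letter n by <:].

Definition num n (x : letter n) : nat := (letter_val x).1.
Definition dots n (x : letter n) : nat := (letter_val x).2.

Section DottedRSK.
Variable n : nat.
Implicit Types (x y : letter n) (r s : seq (letter n)).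

Definition lt_letter x y := num x < num y.

(* Letters with the same integer and different dots are incomparable for
   [lt_letter]; "weakly increasing" ignores dots and means "not decreasing". *)
Definition le_letter x y := num x <= num y.

(* A filling of a Young diagram is the sequence of its rows (English notation). *)
Definition filling := seq (seq (letter n)).

Definition shape (t : filling) : seq nat := map size t.

Definition is_partition (sh : seq nat) : bool := sorted geq sh && (0 \notin sh).

Definition column (t : filling) (j : nat) : seq (letter n) :=
  pmap (fun r => onth r j) t.

Definition dotted_ssyt (t : filling) : bool :=
  [&& is_partition (shape t),
      all (sorted le_letter) t &
      all (fun j => sorted lt_letter (column t j))
          (iota 0 (head 0 (shape t)))].

(* A biword is the sequence of its columns, each one a pair (top, bottom). *)
Definition array := seq (letter n * letter n).

Definition upper (b : array) : seq (letter n) := map fst b.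
Definition lower (b : array) : seq (letter n) := map snd b.

Definition undot (c : letter n * letter n) : nat *l nat := (num c.1, num c.2).

Definition biword (b : array) : bool :=
  sorted (fun c d => (undot c <= undot d)%O) b.

Definition same_shape_pair (p : filling * filling) : bool :=
  [&& dotted_ssyt p.1, dotted_ssyt p.2 & shape p.1 == shape p.2].

(* The pair returned is (new tableau, created cell), cells being (row, column)
   indexed from 0. *)
Fixpoint row_insert (t : filling) x : filling * (nat * nat) :=
  if t is r :: t' then
    let p := find (lt_letter x) r in
    if p < size r then
      let: (t'', (i, j)) := row_insert t' (nth x r p) in
      (set_nth x r p x :: t'', (i.+1, j))
    else (rcons r x :: t', (0, size r))
  else ([:: [:: x]], (0, 0)).

Definition place (u : filling) (cell : nat * nat) x : filling :=
  set_nth [::] u cell.1 (set_nth x (nth [::] u cell.1) cell.2 x).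

Definition rsk_step (p : filling * filling) (c : letter n * letter n) :
    filling * filling :=
  let: (t, cell) := row_insert p.1 c.2 in (t, place p.2 cell c.1).

Definition dotted_rsk (b : array) : filling * filling :=
  foldl rsk_step ([::], [::]) b.

(* Entry [k : 'I_n] counts the letters carrying k+1 dots, i.e. it is m_(k+1). *)
Definition multideg s : n.-tuple nat :=
  [tuple count (fun x => dots x == k.+1) s | k < n].

Definition multideg_array (b : array) : n.-tuple nat * n.-tuple nat :=
  (multideg (lower b), multideg (upper b)).

Definition multideg_filling (t : filling) : n.-tuple nat := multideg (flatten t).

End DottedRSK.

(* Main.v *)
(* Row insertion can be undone once the row of the created cell is known: going
   up, the letter bumped out of a row determines where its replacement sits. It
   remains to recover the created cell from the recording tableau. By the row
   bumping lemma, inserting weakly increasing letters creates cells in strictly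
   increasing columns, so the last created cell is the one whose entry has the
   greatest integer, the rightmost such cell in case of a tie. Conversely, removing
   that cell from an arbitrary pair and undoing the insertion yields a column
   which, by the same lemma, may be appended to the biword of the smaller pair. *)
Require Import Defs.
From mathcomp Require Import all_boot all_order.
From mathcomp Require Import classical_sets functions.
From mathcomp Require Import zify.

Section RSK.
Set Implicit Arguments.
Unset Strict Implicit.
Variable n : nat.
Implicit Types (x y z : letter n) (r h : seq (letter n)) (t u : filling n).

(** * Rows read as integer sequences *)

(** [letter n] offers no default inhabitant (it is empty when [n] is 0), so entries are looked up as
    integers, with default 0. *)
Definition nu r k := nth 0 (map (@num n) r) k.

Lemma nu_cat r h k :
  nu (r ++ h) k = if k < size r then nu r k else nu h (k - size r).
Proof. by rewrite /nu map_cat nth_cat size_map. Qed.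

Lemma nu_rcons r x k : nu (rcons r x) k =
  if k < size r then nu r k else if k == size r then num x else 0.
Proof. by rewrite /nu map_rcons nth_rcons size_map. Qed.

Lemma nu_take m r k : k < m -> nu (take m r) k = nu r k.
Proof. by move=> km; rewrite /nu map_take nth_take. Qed.

Lemma nu_default r k : size r <= k -> nu r k = 0.
Proof. by move=> rk; rewrite /nu nth_default ?size_map. Qed.

Lemma nu_all r k v : all (fun z => num z <= v) r -> nu r k <= v.
Proof. by elim: r k => [|z r IH] [|k] //= /andP[zv rv] //; apply: IH. Qed.

Lemma nu_all_ge r k v : all (fun z => v <= num z) r -> k < size r -> v <= nu r k.
Proof. by elim: r k => [|z r IH] [|k] //= /andP[zv rv] // kr; apply: IH. Qed.

Lemma le_letter_trans : transitive (@le_letter n).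
Proof. by move=> y x z; apply: leq_trans. Qed.

Lemma sorted_nu r k l : sorted (@le_letter n) r -> k <= l -> l < size r ->
  nu r k <= nu r l.
Proof.
move=> rs kl lr; apply: (@sorted_leq_nth _ leq leq_trans leqnn 0).
- by rewrite sorted_map.
- by rewrite inE size_map (leq_ltn_trans kl).
- by rewrite inE size_map.
- exact: kl.
Qed.

Lemma sorted_rconsE r x : sorted (@le_letter n) (rcons r x) =
  all (fun z => num z <= num x) r && sorted (@le_letter n) r.
Proof.
rewrite -cats1 !(sorted_pairwise le_letter_trans) pairwise_cat /= andbT.
by rewrite allrel1r.
Qed.

Lemma sorted_midE r y h : sorted (@le_letter n) (r ++ y :: h) =
  [&& all (fun z => num z <= num y) r, all (fun z => num y <= num z) h,
      allrel (@le_letter n) r h, sorted (@le_letter n) r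
    & sorted (@le_letter n) h].
Proof.
rewrite !(sorted_pairwise le_letter_trans) pairwise_cat /= allrel_consr.
by rewrite -!andbA; do !bool_congr.
Qed.

(** Serves reverse bumping in [ins_rev]: a letter coming back up into a row displaces the last
    letter of the first filter. *)
Lemma sorted_split r v : sorted (@le_letter n) r ->
  r = [seq z <- r | num z < v] ++ [seq z <- r | v <= num z].
Proof.
elim: r => [|z r IH] //= rs; case: (ltnP (num z) v) => zv /=.
  by rewrite -IH ?(path_sorted rs).
move: rs; rewrite (path_sortedE le_letter_trans) => /andP[/allP zr _].
rewrite (eq_in_filter (a2 := pred0)); last first.
  by move=> w /zr zw; apply/negbTE; rewrite -leqNgt; apply: leq_trans zw.
rewrite filter_pred0 (eq_in_filter (a2 := predT)) ?filter_predT //.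
by move=> w /zr zw; apply: leq_trans zw.
Qed.

(** * Tableaux through adjacent rows *)

(** The conjunct [k < size r] packs the decrease of row lengths together with the strictness of
    columns. *)
Definition above r h := forall k, k < size h -> k < size r /\ nu r k < nu h k.

Definition row_ok r h := [/\ r <> [::], sorted (@le_letter n) r & above r h].

(** A local form of [dotted_ssyt], suited to induction on rows. The default row [[::]] makes the
    [above] condition on the last row vacuous. *)
Definition tableau t :=
  forall i, i < size t -> row_ok (nth [::] t i) (nth [::] t i.+1).

Lemma tableau_cons r t :
  tableau (r :: t) <-> row_ok r (head [::] t) /\ tableau t.
Proof.
split=> [T | [R T] [|i] /=]; last exact: T.
  by split=> [|i it]; [rewrite -nth0; apply: (T 0) | apply: (T i.+1)].
by rewrite nth0.
Qed.

Lemma above_size r h : above r h -> size h <= size r.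
Proof.
move=> A; case: (posnP (size h)) => [-> //|h0].
by have [|] := A (size h).-1; [lia|lia].
Qed.

Lemma tableau_size t i k : tableau t -> i <= k ->
  size (nth [::] t k) <= size (nth [::] t i).
Proof.
move=> T; elim: k => [|k IH] ik; first by rewrite (_ : i = 0) //; lia.
move: ik; rewrite leq_eqVlt => /orP[/eqP->//|ik].
apply: leq_trans (IH ik); case: (ltnP k (size t)) => kt.
  by have [_ _ /above_size] := T _ kt.
by rewrite nth_default // leqW.
Qed.

Lemma tableau_nonempty t i : tableau t -> 0 < size (nth [::] t i) = (i < size t).
Proof.
move=> T; case: (ltnP i) => it; last by rewrite nth_default.
have [+ _ _] := T _ it; by case: (nth _ _ i).
Qed.

Lemma tableau_column t i k l : tableau t -> i < k -> l < size (nth [::] t k) ->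
  nu (nth [::] t i) l < nu (nth [::] t k) l.
Proof.
move=> T; elim: k => // k IH ik lk.
have kt : k < size t.
  by rewrite ltnNge; apply/negP => kt; move: lk; rewrite nth_default // leqW.
have [_ _ A] := T _ kt; have [lk' lt] := A _ lk.
move: ik; rewrite ltnS leq_eqVlt => /orP[/eqP->//|ik].
exact: ltn_trans (IH ik lk') lt.
Qed.

Local Arguments column : simpl never.

Lemma column_cons r t j : column (r :: t) j =
  if onth r j is Some x then x :: column t j else column t j.
Proof. by rewrite /column /=; case: (onth r j). Qed.

Lemma onth_nu r j : j < size r -> exists2 x, onth r j = Some x & num x = nu r j.
Proof.
rewrite -onthTE; case E: (onth r j) => [x|] // _; exists x => //.
by rewrite /nu -odflt_onth onth_map E.
Qed.

Lemma column_nil t j : tableau t -> size (head [::] t) <= j -> column t j = [::].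
Proof.
elim: t => [|r t IH] // /tableau_cons[[_ _ A] T] /= rj.
rewrite column_cons onth_default //; apply: IH => //.
exact: leq_trans (above_size A) rj.
Qed.

Lemma tableau_column_sorted t j : tableau t -> sorted (@lt_letter n) (column t j).
Proof.
elim: t => [|r t IH] // /[dup] T0 /tableau_cons[[_ _ A] T].
case: (ltnP j (size r)) => jr; last by rewrite column_nil.
have [x rx xE] := onth_nu jr; rewrite column_cons rx.
case: t => [|h t] //= in T0 A T IH *.
case: (ltnP j (size h)) => jh; last by rewrite column_nil.
have [y hy yE] := onth_nu jh; move: (IH T); rewrite column_cons hy /= => ->.
by rewrite andbT /lt_letter xE yE; case: (A j jh).
Qed.

Lemma dotted_ssyt_behead r t : dotted_ssyt (r :: t) ->
  row_ok r (head [::] t) /\ dotted_ssyt t.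
Proof.
case/and3P=> /andP[/= gs]; rewrite inE negb_or => /andP[r0 n0] /andP[rs ts].
move=> /allP cols.
have size_h : size (head [::] t) <= size r.
  by case: t gs {cols n0 ts} => [|h t] //= /andP[].
(* A column of [r :: t] starts with its entry in [r]: the first link of the path gives [above], the
   remaining ones give the columns of [t]. *)
have col j : j < size r -> exists2 x, onth r j = Some x &
    num x = nu r j /\ path (@lt_letter n) x (column t j).
  move=> jr; have [x rx xE] := onth_nu jr; exists x => //; split=> //.
  by have := cols j; rewrite mem_iota column_cons rx; apply.
split.
  split=> [|//|j jh]; first by case: (r) r0.
  have jr := leq_trans jh size_h; split=> //.
  have [x rx [xE]] := col j jr.
  case: t {gs n0 ts cols col size_h} jh => [|h t] //= jh.
  have [y hy yE] := onth_nu jh; rewrite column_cons hy /= => /andP[+ _].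
  by rewrite /lt_letter xE yE.
rewrite /dotted_ssyt /is_partition (path_sorted gs) n0 ts /=.
apply/allP=> j; rewrite mem_iota /= add0n => jh.
case: (col j) => [|x _ [_ /path_sorted]//].
by apply: leq_trans size_h; case: (t) jh.
Qed.

Lemma dotted_ssytP t : reflect (tableau t) (dotted_ssyt t).
Proof.
apply: (iffP idP).
  elim: t => [|r t IH] // /dotted_ssyt_behead[R /IH T].
  by apply/tableau_cons.
move=> T; apply/and3P; split; last first.
- by apply/allP => j _; apply: tableau_column_sorted.
- by apply/(all_nthP [::]) => i /T[].
apply/andP; split.
  apply/(sortedP 0) => i; rewrite size_map => it.
  by rewrite !(nth_map [::]) // ?(ltnW it) // /geq /= tableau_size.
apply/(nthP 0) => -[i]; rewrite size_map => it.
rewrite (nth_map [::]) // => /eqP.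
by rewrite -leqn0 leqNgt tableau_nonempty // it.
Qed.

(** * Row insertion as a relation *)

(* [ins t x t' i j]: row-inserting [x] into [t] yields [t'] and creates the cell
   [(i, j)]. *)
Inductive ins : filling n -> letter n -> filling n -> nat -> nat -> Prop :=
| InsNil x : ins [::] x [:: [:: x]] 0 0
| InsEnd r t x : all (fun z => num z <= num x) r ->
    ins (r :: t) x (rcons r x :: t) 0 (size r)
| InsBump r y h t x t' i j :
    all (fun z => num z <= num x) r -> num x < num y -> ins t y t' i j ->
    ins ((r ++ y :: h) :: t) x ((r ++ x :: h) :: t') i.+1 j.

Lemma bump_split r x : ~~ all (fun z => num z <= num x) r ->
  exists a y b,
    [/\ r = a ++ y :: b, all (fun z => num z <= num x) a & num x < num y].
Proof.
elim: r => [|z r IH] //=; case: (leqP (num z) (num x)) => zx /=.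
  move=> /IH[a [y [b [-> ax xy]]]]; exists (z :: a), y, b.
  by rewrite /= zx.
by exists [::], z, r.
Qed.

Lemma ins_exists t x : exists t' i j, ins t x t' i j.
Proof.
elim: t x => [|r t IH] x; first by do 3!eexists; apply: InsNil.
case: (boolP (all (fun z => num z <= num x) r)) => [rx|/bump_split].
  by do 3!eexists; apply: InsEnd.
move=> [a [y [b [-> ax xy]]]]; have [t' [i [j I]]] := IH y.
by do 3!eexists; apply: InsBump; eassumption.
Qed.

(** With [ins_exists], this makes [ins] the graph of [row_insert], so that later proofs induct on
    [ins] or invert it instead of computing with [find] and [set_nth]. *)
Lemma row_insert_ins t x t' i j : ins t x t' i j -> row_insert t x = (t', (i, j)).
Proof.
elim=> [{}x|r {}t {}x rx|r y h {}t {}x {}t' {}i {}j rx xy I IH] //=.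
  rewrite ifF //; apply/negbTE; rewrite -has_find -all_predC.
  by apply: sub_all rx => z /=; rewrite /lt_letter -leqNgt.
have -> : find (lt_letter x) (r ++ y :: h) = size r.
  rewrite find_cat ifN /= /lt_letter ?xy ?addn0 // -all_predC.
  by apply: sub_all rx => z /=; rewrite -leqNgt.
rewrite size_cat /= ifT; last by lia.
rewrite nth_cat ltnn subnn /= IH; congr (_ :: _, _).
by elim: r {rx} => //= z r ->.
Qed.

Lemma ins_shape t x t' i j : ins t x t' i j ->
  [/\ i <= size t, j = size (nth [::] t i) & shape t' = incr_nth (shape t) i].
Proof.
elim=> [{}x|r {}t {}x _|r y h {}t {}x {}t' {}i {}j _ _ _ [? ? IH]] //=.
  by rewrite size_rcons.
by rewrite /shape /= !size_cat /= -/(shape t') IH.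
Qed.

Lemma ins_perm t x t' i j : ins t x t' i j ->
  perm_eq (flatten t') (x :: flatten t).
Proof.
elim=> [{}x|r {}t {}x _|r y h {}t {}x {}t' {}i {}j _ _ _ IH] //=.
  by rewrite cat_rcons -cat1s perm_catCA.
rewrite -!catA /= -[x :: h ++ _]cat1s perm_catCA /= perm_cons perm_cat2l.
apply: (perm_trans (y := h ++ y :: flatten t)); first by rewrite perm_cat2l.
by rewrite -cat1s perm_catCA.
Qed.

(** One form for both outcomes: [s] is empty when [x] is appended and starts with the bumped letter
    otherwise; [behead s] fits either. *)
Lemma ins_head t x t' i j : ins t x t' i j -> tableau t ->
  exists a s, [/\ head [::] t = a ++ s, head [::] t' = a ++ x :: behead s,
    all (fun z => num z <= num x) a & all (fun z => num x < num z) s].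
Proof.
case=> [{}x|r {}t {}x rx|r y h {}t {}x {}t' {}i {}j rx xy _] T /=.
- by exists [::], [::].
- by exists r, [::]; rewrite cats0 cats1.
exists r, (y :: h); split=> //=; rewrite xy /=.
have /tableau_cons[[_ + _] _] := T; rewrite sorted_midE => /and5P[_ yh _ _ _].
by apply: sub_all yh => z; apply: leq_trans.
Qed.

(** * Columns of two adjacent rows under a bump *)

Lemma nu_mid r y h k : nu (r ++ y :: h) k =
  if k < size r then nu r k else if k == size r then num y
  else nu h (k - (size r).+1).
Proof.
rewrite nu_cat; case: ltnP => // rk; case: eqVneq => [->|kr].
  by rewrite subnn.
by rewrite (_ : k - size r = (k - (size r).+1).+1) //; lia.
Qed.

Lemma nu_cat_behead r y s k : k != size r ->
  nu (r ++ y :: behead s) k = nu (r ++ s) k.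
Proof.
move=> kr; case: s => [|z s]; rewrite ?nu_mid (negbTE kr) //=.
by rewrite cats0; case: ltnP => // rk; rewrite !nu_default //=; lia.
Qed.

Lemma size_cat_behead r y s :
  size (r ++ y :: behead s) = maxn (size r).+1 (size (r ++ s)).
Proof. by rewrite !size_cat /=; case: s => [|z s] /=; lia. Qed.

(* The bumped letter [y] lands weakly to the left of the cell it leaves. *)
Lemma above_bump r h a s x y :
  all (fun z => num z <= num x) r -> num x < num y ->
  all (fun z => num z <= num y) a -> all (fun z => num y < num z) s ->
  above (r ++ y :: h) (a ++ s) -> above (r ++ x :: h) (a ++ y :: behead s).
Proof.
move=> rx xy ay ys A.
have ar : size a <= size r.
  case: leqP => // ra; have [|_] := A (size r).
    by rewrite size_cat; lia.
  by rewrite nu_mid nu_cat ra ltnn eqxx; have := nu_all (size r) ay; lia.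
move=> k; rewrite size_cat_behead => ks; split.
  rewrite size_cat /=; case: (ltnP k (size (a ++ s))) => [/A[]|]; last by lia.
  by rewrite size_cat.
(* In column [size a] the new lower entry is [y], with [x] or a letter of [r] above it, all at most
   [x]. In the other columns the lower entry is unchanged and the upper one can only decrease. *)
case: (eqVneq k (size a)) => ka.
  subst k; rewrite !nu_mid ltnn eqxx; case: (ltnP (size a) (size r)) => ra.
    by have := nu_all (size a) rx; lia.
  by rewrite ifT //; lia.
rewrite nu_cat_behead //; have [|_] := A k.
  by move: ks; rewrite size_cat; lia.
by rewrite !nu_mid; do !case: ifP => //; lia.
Qed.

(** Here too [y] sits weakly to the left of the place it returns to: otherwise a letter of [h], at
    least [y], would stand above it. So whatever is then below the restored [y] lies in [s] and
    exceeds it. *)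
Lemma above_unbump r h a s x y :
  all (fun z => num y <= num z) h -> num x < num y ->
  all (fun z => num y < num z) s ->
  above (r ++ x :: h) (a ++ y :: behead s) -> above (r ++ y :: h) (a ++ s).
Proof.
move=> yh xy ys A.
have yh' k : k < size h -> num y <= nu h k by apply: nu_all_ge.
have ar : size a <= size r.
  have [|] := A (size a); first by rewrite size_cat_behead; lia.
  rewrite size_cat /= !nu_mid ltnn eqxx; do !case: ifP => //; try lia.
  by move=> ? ?; have := yh' (size a - (size r).+1); lia.
move=> k ks; have [|kr lt] := A k; first by rewrite size_cat_behead; lia.
move: kr; rewrite !size_cat /= => kr; split=> //.
have ys' : size a <= k -> num y < nu (a ++ s) k.
  move=> ak; rewrite nu_cat (ltnNge k) ak; apply: nu_all_ge => //.
  by move: ks; rewrite size_cat; lia.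
have [ka|ka] := eqVneq k (size a).
  move: lt ys'; rewrite ka => + /(_ (leqnn _)).
  by rewrite !nu_mid ltnn eqxx; do !case: ifP => //; lia.
move: lt; rewrite nu_cat_behead // !nu_mid; case: (ltnP k) => // rk.
by case: eqP => // ? _; apply: ys'; lia.
Qed.

Lemma above_rcons r x h : above r h -> above (rcons r x) h.
Proof.
move=> A k /A[kr lt]; rewrite size_rcons nu_rcons kr; split=> //.
exact: ltnW.
Qed.

Lemma tableau_ins t x t' i j : ins t x t' i j -> tableau t -> tableau t'.
Proof.
elim=> [{}x|r {}t {}x rx|r y h {}t {}x {}t' {}i {}j rx xy I IH].
- by move=> _; apply/tableau_cons; split=> // -[].
- move=> /tableau_cons[[_ rs A] T]; apply/tableau_cons; split=> //; split.
  + by case: (r).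
  + by rewrite sorted_rconsE rx.
  + exact: above_rcons.
move=> /tableau_cons[[_ rs A] T]; apply/tableau_cons; split; last exact: IH.
have [a [s [hE h'E ay ys]]] := ins_head I T; split; first by case: (r).
  move: rs; rewrite !sorted_midE rx => /and5P[_ yh -> -> ->]; rewrite !andbT /=.
  by apply: sub_all yh => z; apply/leq_trans/ltnW.
by rewrite h'E; apply: above_bump => //; rewrite -hE.
Qed.

(** * Undoing row insertion *)

Lemma ins_inv0 t x t' j : ins t x t' 0 j ->
  t = [::] /\ t' = [:: [:: x]] \/
  exists r s, [/\ t = r :: s, t' = rcons r x :: s
    & all (fun z => num z <= num x) r].
Proof.
move E: 0 => i I; case: I E => // [{}x _|r {}t {}x rx _]; first by left.
by right; exists r, t.
Qed.

Lemma ins_invS t x t' i j : ins t x t' i.+1 j -> exists r y h s s',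
  [/\ t = (r ++ y :: h) :: s, t' = (r ++ x :: h) :: s',
    all (fun z => num z <= num x) r, num x < num y & ins s y s' i j].
Proof.
move E: i.+1 => k I; case: I E => // r y h {}t {}x {}t' {}k {}j rx xy I [->].
by exists r, y, h, t, t'.
Qed.

(* The bumping position can be read off the new row from the bumped letter [y]. *)
Lemma bump_filter r h x y :
  all (fun z => num z <= num x) r -> num x < num y ->
  sorted (@le_letter n) (r ++ y :: h) ->
  [seq z <- r ++ x :: h | num z < num y] = rcons r x /\
  [seq z <- r ++ x :: h | num y <= num z] = h.
Proof.
move=> rx xy; rewrite sorted_midE => /and5P[_ yh _ _ _].
rewrite !filter_cat /= xy ifN -?ltnNge //.
have /all_filterP -> : all (fun z => num z < num y) r.
  by apply: sub_all rx => z zx; apply: leq_ltn_trans xy.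
have /all_filterP -> : all (fun z => num y <= num z) h by [].
rewrite (eq_in_filter (a2 := pred0)) ?filter_pred0; last first.
  by move=> z /(allP yh) yz; apply/negbTE; rewrite -leqNgt.
rewrite (eq_in_filter (a2 := pred0)) ?filter_pred0; last first.
  by move=> z /(allP rx) zx; apply/negbTE; rewrite -ltnNge (leq_ltn_trans zx).
by rewrite cats1.
Qed.

(** By induction the rows below determine the letter bumped into them, and by [bump_filter] that
    letter determines the split of the row above. *)
Lemma ins_inj t1 t2 x1 x2 t' i j1 j2 :
  ins t1 x1 t' i j1 -> ins t2 x2 t' i j2 -> tableau t1 -> tableau t2 ->
  t1 = t2 /\ x1 = x2.
Proof.
elim: i t1 t2 x1 x2 t' => [|i IH] t1 t2 x1 x2 t' I1 I2.
  case: (ins_inv0 I1) (ins_inv0 I2) => [[-> ->]|[r1 [s1 [-> -> _]]]];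
    case=> [[-> ]|[r2 [s2 [-> + _]]]].
  - by move=> [->].
  (* In the two mixed cases one tableau is empty and the other would have an empty first row. *)
  - by case: r2 => [|z [|? ?]] //= _ _ /tableau_cons[[]].
  - by case: r1 => [|z [|? ?]] //= _ /tableau_cons[[]].
  - by move=> [/rcons_inj[-> ->] ->].
have [r1 [y1 [h1 [s1 [s1' [-> t'E rx1 xy1 {}I1]]]]]] := ins_invS I1; subst t'.
have [r2 [y2 [h2 [s2 [s2' [-> [rE sE] rx2 xy2 {}I2]]]]]] := ins_invS I2.
move=> /tableau_cons[[_ R1 _] T1] /tableau_cons[[_ R2 _] T2].
rewrite -sE in I2; have [sE12 yE] := IH _ _ _ _ _ I1 I2 T1 T2; subst s2 y2.
have [] := bump_filter rx1 xy1 R1; have [] := bump_filter rx2 xy2 R2.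
by rewrite rE => -> -> /rcons_inj[-> ->] ->.
Qed.

(** The size hypothesis says that row [i] ends in a corner. Going up from it, the letter extracted
    from the rows below replaces the last strictly smaller letter of the row, which is extracted in
    turn. *)
Lemma ins_rev t i : tableau t -> i < size t ->
  size (nth [::] t i.+1) < size (nth [::] t i) ->
  exists t1 y j, tableau t1 /\ ins t1 y t i j.
Proof.
elim: t i => [|r t IH] // [|i] /= /tableau_cons[[_ rs A] T].
  rewrite nth0 => _; case/lastP: r rs A => // r x.
  rewrite sorted_rconsE size_rcons => /andP[rx rs] A tr.
  (* If [x] is alone in the first row, the corner condition leaves no row below it. *)
  case: r rs rx A tr => [|z r] rs rx A tr.
    case: t A T tr {IH} => [|h t] A T tr.
      by exists [::], x, 0; split=> //; apply: InsNil.
    by move: (tableau_nonempty 0 T) tr => /=; lia.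
  exists ((z :: r) :: t), x, (size (z :: r)); split; last exact: InsEnd.
  apply/tableau_cons; split=> //; split=> // k kt.
  have kr : k < size (z :: r) by lia.
  by have [_] := A _ kt; rewrite nu_rcons kr.
rewrite ltnS => it ti; have [t1 [y [j [T1 I]]]] := IH _ T it ti.
have [a [s [hE h'E ay ys]]] := ins_head I T1.
have rE := sorted_split (num y) rs; rewrite h'E in A.
(* Above the place of [y] in the next row stands a letter smaller than [y], so the part [r1] of
   letters smaller than [y] is nonempty. *)
have [ar alt] : size a < size r /\ nu r (size a) < num y.
  have [|] := A (size a); first by rewrite size_cat_behead; lia.
  by rewrite nu_mid ltnn eqxx.
set r1 := filter _ _ in rE; set r2 := filter _ _ in rE.
have r2y : all (fun z => num y <= num z) r2 by apply: filter_all.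
have r1y : all (fun z => num z < num y) r1 by apply: filter_all.
clearbody r1 r2; subst r.
case/lastP: r1 rs r1y A ar alt => [|r1 x] rs r1y A ar alt.
  by move: alt; rewrite ltnNge nu_all_ge.
rewrite cat_rcons in rs A *; rewrite all_rcons in r1y; case/andP: r1y => xy r1y.
move: rs; rewrite sorted_midE => /and5P[rx _ r12 r1s r2s].
exists ((r1 ++ y :: r2) :: t1), x, j; split; last exact: InsBump.
apply/tableau_cons; split=> //; split; first by case: (r1).
  rewrite sorted_midE r2y r12 r1s r2s !andbT /=.
  by apply: sub_all r1y => z; apply: ltnW.
by rewrite hE; apply: above_unbump A.
Qed.

(** * Comparing two successive insertions *)

(** For use with [r ++ x :: h] the row left by a first insertion and [y] the letter bumped by a
    second: the cases are [y] left of, at, or right of the place of [x]. *)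
Lemma cat_cons_cmp r x h a y b : r ++ x :: h = a ++ y :: b ->
  [\/ y \in r, y = x | y \in h /\ x \in a].
Proof.
elim: r a => [|z r IH] [|w a] /= [].
- by move=> ->; constructor 2.
- by move=> -> ->; constructor 3; rewrite mem_cat !inE !eqxx orbT.
- by move=> -> _; constructor 1; rewrite inE eqxx.
move=> _ /IH[?|?|[? ?]]; [constructor 1|constructor 2|constructor 3] => //.
  by rewrite inE; apply/orP; right.
by split=> //; rewrite inE; apply/orP; right.
Qed.

Lemma nth_shape t k : nth 0 (shape t) k = size (nth [::] t k).
Proof.
case: (ltnP k (size t)) => kt; first by rewrite (nth_map [::]).
by rewrite !nth_default ?size_map.
Qed.

Lemma ins_col t x t' i j : ins t x t' i j -> tableau t ->
  j < size (head [::] t').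
Proof.
move=> I T; have T' := tableau_ins I T; rewrite -nth0.
apply: leq_trans (tableau_size T' (leq0n i)).
have [_ -> sE] := ins_shape I.
by rewrite -!nth_shape sE nth_incr_nth eqxx.
Qed.

(* The row bumping lemma. *)
Lemma ins_cols t x t1 i1 j1 x' t2 i2 j2 :
  ins t x t1 i1 j1 -> ins t1 x' t2 i2 j2 -> tableau t ->
  (num x <= num x' -> j1 < j2) /\ (num x' < num x -> j2 <= j1).
Proof.
(* The first insertion stops in this row with [y]. If the second one bumps, the bumped letter is at
   most [y], hence [y'] is smaller than [y], and the new cell lies in a lower row, no longer than
   this one. *)
have rcons_case r y s y' u k l : tableau (rcons r y :: s) ->
    ins (rcons r y :: s) y' u k l ->
    (num y <= num y' -> size r < l) /\ (num y' < num y -> l <= size r).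
  move=> T I; have T' := tableau_ins I T; case: k I => [|k] I.
    case: (ins_inv0 I) => [[]//|[? [? [[<- _] _ +]]]].
    have [_ -> _] := ins_shape I.
    rewrite all_rcons /= size_rcons => /andP[yy' _].
    by split=> //; rewrite ltnNge yy'.
  have [a [z [b [v [v' [[E sE] uE ay' y'z {}I]]]]]] := ins_invS I; subst u v.
  move: T T' => /tableau_cons[[_ S _] T] /tableau_cons[[_ _ A] T'].
  split=> [yy'|_].
    have : z \in rcons r y by rewrite E mem_cat inE eqxx orbT.
    rewrite mem_rcons inE; move: S; rewrite sorted_rconsE => /andP[/allP S _].
    by case/predU1P=> [zy|/S]; [move: y'z yy'; rewrite zy|]; lia.
  rewrite -ltnS -(size_rcons r y) E.
  by have := leq_trans (ins_col I T) (above_size A); rewrite !size_cat.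
move=> I1 I2 T; elim: I1 T x' t2 i2 j2 I2 => {t x t1 i1 j1}.
- move=> x T x' t2 i2 j2; apply: (@rcons_case [::]).
  by apply: tableau_ins T; apply: InsNil.
- move=> r t x rx T x' t2 i2 j2; apply: rcons_case.
  by apply: tableau_ins T; apply: InsEnd.
move=> r y h t x t1 i1 j1 rx xy I1 IH T x' t2 [|i2] j2 I2.
  (* Only the first insertion bumps: its cell lies below the first row, at whose end the second one
     stops. *)
  have T1 := tableau_ins (InsBump h rx xy I1) T.
  case: (ins_inv0 I2) => [[]//|[? [? [[<- _] _ +]]]].
  have [_ -> _] := ins_shape I2; rewrite all_cat /= => /and3P[_ xx' _].
  split=> [_|]; last by rewrite ltnNge xx'.
  move: T T1 => /tableau_cons[_ T] /tableau_cons[[_ _ A] _].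
  exact: leq_trans (ins_col I1 T) (above_size A).
(* Both insertions bump: the bumped letters compare as the inserted ones do, so induction applies to
   the rows below. *)
have [a [y' [b [v [v' [[E sE] _ ax' xy' {}I2]]]]]] := ins_invS I2; subst v.
move: T => /tableau_cons[[_ + _] T]; have [lt le] := IH T _ _ _ _ I2.
rewrite sorted_midE => /and5P[_ /allP yh _ _ _].
move/allP: rx => rx; move/allP: ax' => ax'.
by case: (cat_cons_cmp E) => [/rx|?|[/yh ? /ax' ?]]; try subst y';
  split=> *; try apply: lt; try apply: le; lia.
Qed.

(** * Growth of the recording tableau *)

(** When [i = size u], the default row [[::]] makes this open a new row. *)
Definition addcell u i x := set_nth [::] u i (rcons (nth [::] u i) x).

Lemma placeE u i x : place u (i, size (nth [::] u i)) x = addcell u i x.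
Proof.
by rewrite /place /addcell; congr set_nth; elim: (nth _ _ _) => //= ? ? ->.
Qed.

Lemma nth_addcell u i x k : nth [::] (addcell u i x) k =
  if k == i then rcons (nth [::] u i) x else nth [::] u k.
Proof. by rewrite nth_set_nth /=; case: eqVneq. Qed.

Lemma shape_addcell u i x : i <= size u ->
  shape (addcell u i x) = incr_nth (shape u) i.
Proof.
elim: u i => [|r u IH] [|i] //= iu; first by rewrite /shape /= size_rcons.
by rewrite /shape /= -[map size _]/(shape (addcell u i x)) IH.
Qed.

Lemma addcell_perm u i x : i <= size u ->
  perm_eq (flatten (addcell u i x)) (x :: flatten u).
Proof.
elim: u i => [|r u IH] [|i] //= iu.
  by rewrite cat_rcons -cat1s perm_catCA.
apply: (perm_trans (y := r ++ x :: flatten u)).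
  by rewrite perm_cat2l; apply: IH.
by rewrite -cat1s perm_catCA.
Qed.

(* Cells are ordered by value, then by column: all cells of [u] precede an entry
   [v] in column [j]. *)
Definition cells_lt u v j := forall k l, l < size (nth [::] u k) ->
  nu (nth [::] u k) l < v \/ nu (nth [::] u k) l = v /\ l < j.

Lemma cells_lt_addcell u i x : cells_lt u (num x) (size (nth [::] u i)) ->
  cells_lt (addcell u i x) (num x) (size (nth [::] u i)).+1.
Proof.
move=> C k l; rewrite nth_addcell; case: (eqVneq k i) => [ki|_].
  rewrite size_rcons nu_rcons ltnS => ls; case: ifP => [li|_].
    by case: (C i l li) => [|[]]; [left|right].
  by case: eqP => [_|]; [right|lia].
by move=> /C[|[]]; [left|right; split=> //; apply: ltnW].
Qed.

(** The tie-break by column gives strictness: the cell above the new one lies in the same column, so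
    its integer cannot equal that of [x]. *)
Lemma tableau_addcell u i x : tableau u -> i <= size u ->
  cells_lt u (num x) (size (nth [::] u i)) ->
  (forall k, size (nth [::] (addcell u i x) k.+1) <=
             size (nth [::] (addcell u i x) k)) ->
  tableau (addcell u i x).
Proof.
move=> U iu C S k; rewrite size_set_nth => ku; move: (S k) => {S}.
have Uk : k != i -> k < size u by lia.
rewrite !nth_addcell; case: (eqVneq k i) => [ki|/Uk {}ku].
  subst k; rewrite ifN ?gtn_eqF // => S.
  split; first by case: (nth _ _ _).
    rewrite sorted_rconsE; apply/andP; split; last first.
      by case: (ltnP i (size u)) => [/U[]//|ui]; rewrite nth_default.
    apply/(all_nthP x) => l li; have := C i l li.
    by rewrite /nu (nth_map x) // => -[/ltnW|[->]].
  case: (ltnP i (size u)) => [/U[_ _ A]|ui]; first exact: above_rcons.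
  by rewrite [nth _ _ i.+1]nth_default // leqW.
have [u0 us A] := U _ ku; case: eqVneq => // ki; rewrite size_rcons => S.
rewrite ki in A; split=> // l; rewrite size_rcons nu_rcons ltnS => li.
case: ifP => [/A //|ni]; have -> : l = size (nth [::] u i) by lia.
rewrite eqxx; split=> //; case: (C k _ S) => // -[_].
by rewrite ltnn.
Qed.

Lemma size_incr_row u (v : filling n) i k : shape v = incr_nth (shape u) i ->
  size (nth [::] v k) = (i == k) + size (nth [::] u k).
Proof. by move=> vE; rewrite -!nth_shape vE nth_incr_nth. Qed.

Lemma shape_size t u : shape t = shape u -> size t = size u.
Proof.
by move=> E; rewrite -(size_map size t) -(size_map size u) -/(shape t) E.
Qed.

Lemma size_row t u k : shape t = shape u ->
  size (nth [::] t k) = size (nth [::] u k).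
Proof. by move=> E; rewrite -!nth_shape E. Qed.

(** * Dotted RSK on biwords *)

Definition ssyt_pair (p : filling n * filling n) :=
  [/\ tableau p.1, tableau p.2 & shape p.1 = shape p.2].

Lemma same_shape_pairP p : reflect (ssyt_pair p) (same_shape_pair p).
Proof.
apply: (iffP and3P) => [[/dotted_ssytP ? /dotted_ssytP ? /eqP] | [? ? ?]] //.
by split; [apply/dotted_ssytP..|apply/eqP].
Qed.

Lemma rsk_step_ins t u c t' i j : ins t c.2 t' i j -> shape t = shape u ->
  rsk_step (t, u) c = (t', addcell u i c.1).
Proof.
move=> I tu; rewrite /rsk_step /= (row_insert_ins I).
by have [_ -> _] := ins_shape I; rewrite (size_row _ tu) placeE.
Qed.

(** Since [t'] is already a tableau, its shape supplies the decreasing row lengths for the recording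
    side. *)
Lemma ssyt_pair_step t u x y t' i j : ssyt_pair (t, u) -> ins t y t' i j ->
  cells_lt u (num x) j -> ssyt_pair (t', addcell u i x).
Proof.
move=> [/= T U tu] I C; have [it jE t'E] := ins_shape I.
have iu : i <= size u by rewrite -(shape_size tu).
have shE : shape t' = shape (addcell u i x) by rewrite shape_addcell // -tu.
split=> //=; first exact: tableau_ins I T.
apply: tableau_addcell => //; first by rewrite -(size_row _ tu) -jE.
move=> k; rewrite -!(size_row _ shE).
by apply: tableau_size => //; apply: tableau_ins I T.
Qed.

Lemma dotted_rsk_rcons (b : array n) c :
  dotted_rsk (rcons b c) = rsk_step (dotted_rsk b) c.
Proof. by rewrite /dotted_rsk foldl_rcons. Qed.

Lemma biword_rcons2 (b : array n) c d : biword (rcons (rcons b c) d) =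
  biword (rcons b c) &&
  ((num c.1 < num d.1) || (num c.1 == num d.1) && (num c.2 <= num d.2)).
Proof.
have -> : biword (rcons (rcons b c) d) =
    biword (rcons b c) && (undot c <= undot d)%O.
  case: b => [|a b]; first by rewrite /biword /= andbT.
  by rewrite /biword /= rcons_path last_rcons.
rewrite /undot lexi_pair !leEnat; by congr (_ && _) => /=; lia.
Qed.

Lemma biword_belast (b : array n) c : biword (rcons b c) -> biword b.
Proof. by case/lastP: b => // b d; rewrite biword_rcons2 => /andP[]. Qed.

(* By the row bumping lemma, top letters with equal integers are placed from left
   to right. *)
Lemma rsk_cells_lt (b : array n) c : biword (rcons b c) ->
  ssyt_pair (dotted_rsk b) /\
  forall t' i j, ins (dotted_rsk b).1 c.2 t' i j ->
    cells_lt (dotted_rsk b).2 (num c.1) j.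
Proof.
elim/last_ind: b c => [|b d IH] c.
  by move=> _; split=> // t' i j _ k l; rewrite nth_nil.
rewrite biword_rcons2 dotted_rsk_rcons => /andP[/IH[+ C] dc].
case: (dotted_rsk b) C => t u /= C P; have [/= T U tu] := P.
have [t1 [i [j I]]] := ins_exists t d.2.
rewrite (rsk_step_ins I tu) /=; split.
  by apply: (ssyt_pair_step P I); apply: C I.
move=> t2 i2 j2 I2 k l kl; have jE : j = size (nth [::] u i).
  by have [_ -> _] := ins_shape I; apply: size_row.
have := C _ _ _ I; rewrite jE => /cells_lt_addcell /(_ _ _ kl).
rewrite -jE ltnS => {}C; have [lt_j _] := ins_cols I I2 T.
by case/orP: dc => [dc|/andP[/eqP dc /lt_j ?]]; lia.
Qed.

Lemma rsk_ssyt_pair (b : array n) : biword b -> ssyt_pair (dotted_rsk b).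
Proof.
case/lastP: b => // b c bc; have [P C] := rsk_cells_lt bc.
rewrite dotted_rsk_rcons; case: (dotted_rsk b) P C => t u /= P C.
have [t1 [i [j I]]] := ins_exists t c.2.
rewrite (rsk_step_ins I); last by case: P.
by apply: (ssyt_pair_step P I); apply: C I.
Qed.

(** The multidegree identity rests on this; through lengths it also separates the empty biword from
    the others in [rsk_inj]. *)
Lemma rsk_perm (b : array n) : biword b ->
  perm_eq (flatten (dotted_rsk b).1) (lower b) /\
  perm_eq (flatten (dotted_rsk b).2) (upper b).
Proof.
elim/last_ind: b => // b c IH bc; have {IH}[] := IH (biword_belast bc).
have := rsk_ssyt_pair (biword_belast bc).
rewrite dotted_rsk_rcons /lower /upper !map_rcons.
case: (dotted_rsk b) => t u [/= _ _ tu] tb ub.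
have [t1 [i [j I]]] := ins_exists t c.2.
have [it _ _] := ins_shape I; rewrite (shape_size tu) in it.
rewrite (rsk_step_ins I tu) /=; split.
  apply: perm_trans (ins_perm I) _.
  by rewrite perm_sym perm_rcons perm_cons perm_sym.
apply: perm_trans (addcell_perm _ it) _.
by rewrite perm_sym perm_rcons perm_cons perm_sym.
Qed.

(** * Injectivity *)

(* The last created cell is the greatest cell of the recording tableau. *)
Lemma addcell_inj u1 u2 i1 i2 x1 x2 :
  addcell u1 i1 x1 = addcell u2 i2 x2 ->
  cells_lt u1 (num x1) (size (nth [::] u1 i1)) ->
  cells_lt u2 (num x2) (size (nth [::] u2 i2)) -> i1 = i2 /\ x1 = x2.
Proof.
move=> E C1 C2; have [ii|ii] := eqVneq i1 i2.
  subst i2; have := congr1 (fun u => nth [::] u i1) E.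
  by rewrite /= !nth_addcell eqxx => /rcons_inj[_ ->].
(* If the rows differ, each added cell is an old cell of the other tableau, so each would strictly
   precede the other. *)
have R1 := congr1 (fun u => nth [::] u i1) E.
have R2 := congr1 (fun u => nth [::] u i2) E.
rewrite /= !nth_addcell eqxx (negbTE ii) in R1.
rewrite /= !nth_addcell eqxx eq_sym (negbTE ii) in R2.
have := C2 i1 (size (nth [::] u1 i1)); have := C1 i2 (size (nth [::] u2 i2)).
rewrite -R1 R2 !size_rcons !nu_rcons !ltnn !eqxx.
move=> /(_ (leqnn _)) ? /(_ (leqnn _)).
by lia.
Qed.

Lemma addcell_injl u1 u2 i x : shape u1 = shape u2 ->
  addcell u1 i x = addcell u2 i x -> u1 = u2.
Proof.
move=> sE E; apply: (@eq_from_nth _ [::]) => [|k _]; first exact: shape_size.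
have := congr1 (fun u => nth [::] u k) E; rewrite /= !nth_addcell.
by case: eqP => // -> /rcons_inj[].
Qed.

Lemma rsk_inj (b1 b2 : array n) : biword b1 -> biword b2 ->
  dotted_rsk b1 = dotted_rsk b2 -> b1 = b2.
Proof.
have nil_rcons (b : array n) c :
    biword (rcons b c) -> dotted_rsk (rcons b c) <> ([::], [::]).
  move=> /rsk_perm[/perm_size + _] E; rewrite E /lower map_rcons size_rcons.
  by [].
elim/last_ind: b1 b2 => [|b1 c1 IH] b2.
  by case/lastP: b2 => // b2 c2 _ /nil_rcons B /esym.
case/lastP: b2 => [/nil_rcons//|b2 c2] B1 B2; rewrite !dotted_rsk_rcons => E.
have [P1 C1] := rsk_cells_lt B1; have [P2 C2] := rsk_cells_lt B2.
have {}IH := IH b2 (biword_belast B1) (biword_belast B2).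
case: (dotted_rsk b1) (dotted_rsk b2) => [t1 u1] [t2 u2] in IH P1 C1 P2 C2 E *.
have [/= T1 _ tu1] := P1; have [/= T2 _ tu2] := P2.
have [t1' [i1 [j1 I1]]] := ins_exists t1 c1.2.
have [t2' [i2 [j2 I2]]] := ins_exists t2 c2.2.
move: E; rewrite (rsk_step_ins I1 tu1) (rsk_step_ins I2 tu2) => -[t'E uE].
have [_ j1E _] := ins_shape I1; have [_ j2E _] := ins_shape I2.
have [] := addcell_inj uE.
- by rewrite -(size_row _ tu1) -j1E; apply: C1 I1.
- by rewrite -(size_row _ tu2) -j2E; apply: C2 I2.
(* The recording tableaux have given the row of the created cell, from which both insertions can be
   undone. *)
move=> iE xE; rewrite -iE -t'E in I2; have [tE yE] := ins_inj I1 I2 T1 T2.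
subst t2; rewrite -iE -xE in uE.
have uu := addcell_injl (etrans (esym tu1) tu2) uE.
rewrite IH ?uu //; congr rcons.
by case: (c1) (c2) xE yE => ? ? [? ?] /= -> ->.
Qed.

(** * Surjectivity *)

(** The greatest cell ends its row, so it is found by maximizing over rows the last integer, then
    the row length, which orders row ends by column. *)
Lemma max_cell u : tableau u -> 0 < size u -> exists s i x,
  [/\ nth [::] u i = rcons s x, i < size u &
   forall k l, l < size (nth [::] u k) -> k != i \/ l < size s ->
     nu (nth [::] u k) l < num x \/ nu (nth [::] u k) l = num x /\ l < size s].
Proof.
move=> U u0; pose R k := nth [::] u k.
pose key (k : 'I_(size u)) : nat *l nat :=
  (nu (R k) (size (R k)).-1, size (R k)).
case: (@Order.TotalTheory.arg_maxP _ _ _ (Ordinal u0) xpredT key isT).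
move=> i _ imax.
have [s [x E]] : exists s x, nth [::] u i = rcons s x.
  have [] := U i (ltn_ord i); case/lastP: (nth _ u i) => // s x _ _ _.
  by exists s, x.
exists s, (i : nat), x; split=> // k l lk ki.
have ku : k < size u.
  by rewrite -(tableau_nonempty _ U); apply: leq_ltn_trans lk.
have : (key (Ordinal ku) <= key i)%O by apply: imax.
rewrite /key /R lexi_pair !leEnat /= E size_rcons /= nu_rcons ltnn eqxx.
have [_ ks _] := U k ku.
have kl := sorted_nu (k := l) (l := (size (nth [::] u k)).-1) ks.
(* For [k] other than [i], strictness of columns excludes a tie with [x] in column [size s]
   itself. *)
have [ik|ik|ik] := ltngtP k i.
- have := tableau_column (k := i) (l := l) U ik.
  by rewrite E size_rcons nu_rcons; do !case: ifP => //; lia.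
- have := tableau_column U ik lk.
  by rewrite E nu_rcons; do !case: ifP => //; lia.
have ls : l < size s by case: ki => //; rewrite ik eqxx.
move: kl; rewrite ik E size_rcons /= [nu _ (size s)]nu_rcons ltnn eqxx.
by move=> /(_ (ltnW ls) (ltnSn _)) kl _; lia.
Qed.

Lemma rsk_surj t u : ssyt_pair (t, u) ->
  exists2 b, biword b & dotted_rsk b = (t, u).
Proof.
move: {2}(size _) (leqnn (size (flatten u))) => m.
elim: m t u => [|m IH] t u um P; have [/= T U tu] := P.
  have u0 : u = [::].
    by case: u U um {P tu} => [|[|? ?] u] // /tableau_cons[[]].
  by exists [::] => //; move/shape_size: tu; rewrite u0; case: (t).
have [u0|u0] := posnP (size u).
  exists [::] => //; move/shape_size: tu; rewrite u0.
  by move/size0nil: u0 => -> /size0nil->.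
have [s [i [x [iE iu imax]]]] := max_cell U u0.
(* The greatest cell is a corner: a cell just below it would hold a larger integer. *)
have ti : size (nth [::] t i.+1) < size (nth [::] t i).
  rewrite !(size_row _ tu) ltn_neqAle tableau_size // andbT; apply/eqP => sE.
  have si : size s < size (nth [::] u i.+1) by rewrite sE iE size_rcons.
  have := tableau_column U (ltnSn i) si; rewrite iE nu_rcons ltnn eqxx => lt.
  by case: (imax _ _ si) => [||[_]]; [left|..]; lia.
have it : i < size t by rewrite (shape_size tu).
have [t1 [y [j [T1 I]]]] := ins_rev T it ti; have [it1 jE tE] := ins_shape I.
have tR k := size_incr_row k tE.
(* Trimming the rows of [u] to the lengths of those of [t1] removes exactly the greatest cell and
   gives equal shapes by construction. *)
pose u1 : filling n :=
  mkseq (fun k => take (size (nth [::] t1 k)) (nth [::] u k)) (size t1).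
have u1R k : nth [::] u1 k = take (size (nth [::] t1 k)) (nth [::] u k).
  have [kt|kt] := ltnP k (size t1); first by rewrite nth_mkseq.
  by rewrite [LHS]nth_default ?size_mkseq // [nth _ t1 k]nth_default // take0.
have u1n : size u1 = size t1 by apply: size_mkseq.
clearbody u1; have u1S k : size (nth [::] u1 k) = size (nth [::] t1 k).
  by rewrite u1R size_takel // -(size_row _ tu) tR leq_addl.
have tu1 : shape t1 = shape u1.
  apply: (@eq_from_nth _ 0) => [|k _]; first by rewrite !size_map.
  by rewrite !nth_shape u1S.
have js : j = size s.
  have := tR i; rewrite (size_row _ tu) iE size_rcons eqxx -jE; lia.
have uE : addcell u1 i x = u.
  apply: (@eq_from_nth _ [::]) => [|k _].
    have := congr1 size tE; rewrite size_incr_nth !size_map size_set_nth u1n.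
    by rewrite -(shape_size tu); case: ifP; lia.
  rewrite nth_addcell; case: eqVneq => [->|ki].
    by rewrite u1R iE -jE js -!cats1 take_size_cat.
  rewrite u1R take_oversize // -(size_row _ tu) tR.
  by rewrite eq_sym (negbTE ki).
have P1 : ssyt_pair (t1, u1).
  split=> //= k; rewrite u1n => kt; have [r0 _ _] := T1 k kt.
  have ku : k < size u.
    rewrite -(tableau_nonempty _ U) -(size_row _ tu) tR.
    by rewrite addn_gt0 (tableau_nonempty _ T1) kt orbT.
  have [_ us A] := U k ku; split.
  - by move: r0 (u1S k); case: (nth _ t1 k) => // ? ? _ ; case: (nth _ u1 k).
  - by rewrite u1R take_sorted.
  move=> l; rewrite u1S => lk; rewrite !u1S.
  have lk' := leq_trans lk (tableau_size T1 (leqnSn k)).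
  split=> //; rewrite !u1R !nu_take //; case: (A l) => //.
  by rewrite -(size_row _ tu) tR; lia.
have C : cells_lt u1 (num x) j.
  move=> k l; rewrite u1S => lk; rewrite u1R nu_take // js; apply: imax.
    by rewrite -(size_row _ tu) tR; lia.
  by have [ki|] := eqVneq k i; [right; rewrite -js jE -ki|left].
have [|b B bE] := IH t1 u1 _ P1.
  have := perm_size (addcell_perm x (u := u1) (i := i) _).
  rewrite uE /= u1n => /(_ it1); lia.
exists (rcons b (x, y)); last first.
  by rewrite dotted_rsk_rcons bE (rsk_step_ins (c := (x, y)) I) //= uE.
case/lastP: b B bE => // b [x0 y0] B bE; rewrite biword_rcons2 B /=.
have [P0 C0] := rsk_cells_lt B; rewrite dotted_rsk_rcons in bE.
case: (dotted_rsk b) P0 C0 bE => t0 u0' P0 C0; have [/= T0 _ tu0] := P0.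
have [t1' [i0 [j0 I0]]] := ins_exists t0 y0.
rewrite (rsk_step_ins (c := (x0, y0)) I0) //= => -[t1E u1E]; subst t1'.
have [_ j0E _] := ins_shape I0.
(* The last cell of [u1] holds [x0] in column [j0], so [x0] is smaller than [x], or they tie and
   [j0 < j]. In a tie, [y] smaller than [y0] would force [j <= j0] by the row bumping lemma. *)
have := C i0 j0; rewrite -u1E nth_addcell eqxx size_rcons nu_rcons.
rewrite -(size_row _ tu0) -j0E ltnn eqxx => /(_ (ltnSn _)).
have [_ le] := ins_cols I0 I T0.
by case: (leqP (num y0) (num y)) => [|/le]; lia.
Qed.

End RSK.

Theorem theorem8p1 (n : nat) (hn : 1 <= n) :
  set_bij [set b : array n | biword b]%classic
          [set p : filling n * filling n | same_shape_pair p]%classic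
          (@dotted_rsk n) /\
  (forall b : array n, biword b ->
     multideg_array b =
     (multideg_filling (dotted_rsk b).1, multideg_filling (dotted_rsk b).2)).
Proof.
split; last first.
  (* Multidegrees are counts, hence invariant under permutation of the entries. *)
  move=> b /rsk_perm[/permP lE /permP uE].
  rewrite /multideg_array.
  by congr pair; apply: eq_from_tnth => k; rewrite !tnth_mktuple.
split.
- by move=> b /= B; apply/same_shape_pairP/rsk_ssyt_pair.
- by move=> b1 b2; rewrite !inE /=; apply: rsk_inj.
- move=> [t u] /= /same_shape_pairP/rsk_surj[b B bE].
  by exists b.
Qed.
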